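(* Let $X,Y,Z$ be sorts of a graded probability space. Suppose that $E\in\mathcal{B}_{X\times Y\times Z}$, $E_x\in\mathcal{B}_{Y\times Z}$ is $\mu$-stable for almost all $x\in X$, and $E_y\in\mathcal{B}_{X\times Z}$ is $\mu$-stable for almost all $y\in Y$. Then there is a countable partition of $X\times Y$ into $\mathcal{B}^E_{X\times Y}$-measurable sets perfect for $E$, viewed as a binary relation on $(X\times Y)\times Z$.
   Context: Graded probability space: fix base sets $V_1,\dots,V_k$; a sort is any finite cartesian product of the $V_i$'s, in any order and possibly with repetitions. A ($k$-partite) graded probability space specifies for each sort $X$ a $\sigma$-algebra $\mathcal{B}_X\subseteq\mathcal{P}(X)$ and a countably additive probability measure $\mu_X$ on it (both often written without subscript) such that for all sorts $X,Y$: $\mathcal{B}_{X\times Y}\supseteq\mathcal{B}_X\times\mathcal{B}_Y$ and $\mu_{X\times Y}$ extends the product measure; permuting coordinates preserves measurability and measure; and (Fubini) for $A\in\mathcal{B}_{X\times Y}$, $A_y\in\mathcal{B}_X$ for $\mu_Y$-almost every $y$, $y\mapsto\mu_X(A_y)$ is $\mu_Y$-measurable and $\mu_{X\times Y}(A)=\int_Y\mu_X(A_y)\,d\mu_Y$. Subscripts denote fibers: $E_x=\{(y,z):(x,y,z)\in E\}$, etc. $\mu$-stability: for $R\in\mathcal{B}_{X\times Y}$ and $d\ge1$, let $\mathrm{Tree}^{R,d}\subseteq X^{2^d}\times Y^{2^d-1}$ be the set of tuples $(a_\sigma:\sigma\in2^d)^\frown(b_\sigma:\sigma\in2^{<d})$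 with $(a_\sigma,b_{\sigma|_i})\in R\iff\sigma(i)=1$ for all $\sigma\in2^d$ (0-1 sequences of length $d$), $i<d$, where $\sigma|_i$ is the initial segment of length $i$. $R$ is $d$-$\mu$-stable if $\mu(\mathrm{Tree}^{R,d})=0$, and $\mu$-stable if it is $d$-$\mu$-stable for some $d$. Perfect sets: for $R\in\mathcal{B}_{X\times Y}$, $A\in\mathcal{B}_X$ is perfect for $R$ if for $\mu_Y$-almost every $b\in Y$, $\mu(A\cap R_b)=0$ or $\mu(A\setminus R_b)=0$ (where $R_b=\{a:(a,b)\in R\}$). Algebras of fibers: let $E\in\mathcal{B}_W$ with $W=\prod_{t\in[K]}V_{i_t}$. For $I\subseteq[K]$ and $W_I=\prod_{t\in I}V_{i_t}$, let $\mathcal{F}^{0,E}_{W_I}$ be the collection of all fibers $E_{\bar b}\subseteq W_I$, $\bar b\in\prod_{t\in[K]\setminus I}V_{i_t}$, and their complements (all these are taken to be in $\mathcal{B}_{W_I}$). For a sort $S=\prod_{t\in[L]}V_{j_t}$, $\mathcal{F}^{E,N}_S$ is the collection of sets $\{(b_i:i\in[L])\in S:\bigwedge_{\ell\in[N]}(b_i:i\in J_\ell)\in S_\ell\}$ with $J_\ell\subseteq[L]$, $I_\ell\subseteq[K]$, $(j_t:t\in J_\ell)=(i_t:t\in I_\ell)$ and $S_\ell\in\mathcal{F}^{0,E}_{W_{I_\ell}}$. $\mathcal{B}^E_S$ is the $\sigma$-algebra generated by $\bigcup_N\mathcal{F}^{E,N}_S$. *)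

(* Defs.v *)
From HB Require Import structures.
From mathcomp Require Import all_boot all_order all_algebra.
From mathcomp Require Import all_classical all_reals all_analysis.
From mathcomp Require Import measurable_realfun.

Set Implicit Arguments.
Unset Strict Implicit.
Unset Printing Implicit Defensive.

Local Open Scope classical_set_scope.

(* A sort V_{i_1} x ... x V_{i_n} is the sequence [:: i_1; ...; i_n].
   A point of it is a sequence of elements of the disjoint union of the V_i
   whose successive tags are i_1, ..., i_n.  With this encoding, equalities
   between sorts such as X ++ (Y ++ Z) = (X ++ Y) ++ Z leave the underlying
   sequence of a point unchanged.
   The base sets are pointed types because measurable types are pointed; a base
   set carrying a probability measure is nonempty anyway. *)
Definition pt (k : nat) (V : 'I_k -> pointedType) (s : seq 'I_k) : Type :=
  {p : seq {i : 'I_k & V i} | map tag p == s}.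

Section Points.
Context {k : nat} {V : 'I_k -> pointedType}.
Implicit Types s X Y Z : seq 'I_k.

HB.instance Definition _ s := Choice.on (pt V s).

Definition mk_pt s (p : seq {i : 'I_k & V i}) (e : map tag p == s) : pt V s :=
  exist (fun q : seq {i : 'I_k & V i} => map tag q == s) p e.
Arguments mk_pt {s} p e.

Lemma pt_default_subproof s : map tag [seq Tagged V (point : V i) | i <- s] == s.
Proof. by rewrite -map_comp map_id. Qed.

HB.instance Definition _ s :=
  isPointed.Build (pt V s) (mk_pt _ (pt_default_subproof s)).

Definition pt_cast s s' (e : s = s') (p : pt V s) : pt V s' :=
  eq_rect s (pt V) p s' e.

Lemma pt_cat_subproof X Y (x : pt V X) (y : pt V Y) :
  map tag (val x ++ val y) == X ++ Y.
Proof. by rewrite map_cat (eqP (valP x)) (eqP (valP y)). Qed.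

Definition pt_cat X Y (x : pt V X) (y : pt V Y) : pt V (X ++ Y) :=
  mk_pt (val x ++ val y) (pt_cat_subproof x y).

Lemma pt_fst_subproof X Y (p : pt V (X ++ Y)) :
  map tag (take (size X) (val p)) == X.
Proof. by rewrite map_take (eqP (valP p)) take_size_cat. Qed.

Definition pt_fst X Y (p : pt V (X ++ Y)) : pt V X :=
  mk_pt (take (size X) (val p)) (pt_fst_subproof p).

Lemma pt_snd_subproof X Y (p : pt V (X ++ Y)) :
  map tag (drop (size X) (val p)) == Y.
Proof. by rewrite map_drop (eqP (valP p)) drop_size_cat. Qed.

Definition pt_snd X Y (p : pt V (X ++ Y)) : pt V Y :=
  mk_pt (drop (size X) (val p)) (pt_snd_subproof p).

End Points.

Arguments mk_pt {k V s} p e.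

(* The subsequence of the items of s at the positions listed in u (positions
   beyond the end of s are dropped). *)
Definition coords T (u : seq nat) (s : seq T) : seq T := pmap (onth s) u.

Lemma map_coords T T' (f : T -> T') u (s : seq T) :
  map f (coords u s) = coords u (map f s).
Proof.
rewrite /coords; elim: u => //= n u <-.
by rewrite onth_map; case: (onth s n).
Qed.

Section Coordinates.
Context {k : nat} {V : 'I_k -> pointedType}.

Lemma pt_coords_subproof (u : seq nat) (s : seq 'I_k) (p : pt V s) :
  map tag (coords u (val p)) == coords u s.
Proof. by rewrite map_coords (eqP (valP p)). Qed.

Definition pt_coords (u : seq nat) (s : seq 'I_k) (p : pt V s) :
    pt V (coords u s) :=
  mk_pt (coords u (val p)) (pt_coords_subproof u p).

End Coordinates.

Arguments pt_coords {k V} u {s} p.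

(* The elements of a set of positions, in increasing order. *)
Definition positions (n : nat) (I : {set 'I_n}) : seq nat := map val (enum I).

Section Fibers.
Context {k : nat} {V : 'I_k -> pointedType}.
Implicit Types X Y Z W : seq 'I_k.

Definition fiber_fst X Y (A : set (pt V (X ++ Y))) (x : pt V X) : set (pt V Y) :=
  [set y | A (pt_cat x y)].

Definition fiber_snd X Y (A : set (pt V (X ++ Y))) (y : pt V Y) : set (pt V X) :=
  [set x | A (pt_cat x y)].

Definition fiber_mid X Y Z (A : set (pt V (X ++ (Y ++ Z)))) (y : pt V Y) :
    set (pt V (X ++ Z)) :=
  [set p | A (pt_cat (pt_fst p) (pt_cat y (pt_snd p)))].

(* The fiber over b of a set E in a sort W, where b gives the coordinates
   outside I: a belongs to it iff the point w of W with coordinates a in I and b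
   outside I belongs to E. *)
Definition fiber_at W (E : set (pt V W)) (I : {set 'I_(size W)})
    (b : pt V (coords (positions (~: I)) W)) :
    set (pt V (coords (positions I) W)) :=
  [set a | exists w : pt V W, [/\ E w,
     pt_coords (positions I) w = a & pt_coords (positions (~: I)) w = b]].

(* E, viewed as a binary relation on (X x Y) x Z. *)
Definition rel_assoc X Y Z (E : set (pt V (X ++ (Y ++ Z)))) :
    set (pt V ((X ++ Y) ++ Z)) :=
  [set p | E (pt_cast (esym (catA X Y Z)) p)].

End Fibers.

(* As gps_B s is a sigma-algebra, it coincides with the family of measurable
   sets of the measurable type g_sigma_algebraType (gps_B s).
   In gps_fubini, the measure of the fiber at y is only meaningful for the almost
   all y whose fiber is measurable, so its measurability as a function of y is
   expressed by an almost everywhere equal measurable function f. *)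
Record gradedProbabilitySpace (R : realType) (k : nat) (V : 'I_k -> pointedType)
  := GradedProbabilitySpace {
  gps_B : forall s : seq 'I_k, set (set (pt V s));
  gps_sigma_algebra : forall s, sigma_algebra setT (@gps_B s);
  gps_mu : forall s, probability (g_sigma_algebraType (@gps_B s)) R;
  gps_product : forall (X Y : seq 'I_k)
    (A : set (g_sigma_algebraType (@gps_B X) * g_sigma_algebraType (@gps_B Y))),
    measurable A ->
    @gps_B (X ++ Y) [set p | A (pt_fst p, pt_snd p)] /\
    gps_mu (X ++ Y) [set p | A (pt_fst p, pt_snd p)] =
      (gps_mu X \x gps_mu Y)%E A;
  gps_perm : forall (s : seq 'I_k) (u : seq nat) (A : set (pt V (coords u s))),
    perm_eq u (iota 0 (size s)) -> @gps_B (coords u s) A ->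
    @gps_B s (pt_coords u @^-1` A) /\
    gps_mu s (pt_coords u @^-1` A) = gps_mu (coords u s) A;
  gps_fubini : forall (X Y : seq 'I_k) (A : set (pt V (X ++ Y))),
    @gps_B (X ++ Y) A ->
    exists f : g_sigma_algebraType (@gps_B Y) -> \bar R,
      [/\ measurable_fun setT f,
          \forall y \ae gps_mu Y,
            @gps_B X (fiber_snd A y) /\ f y = gps_mu X (fiber_snd A y) &
          gps_mu (X ++ Y) A = (\int[gps_mu Y]_y f y)%E]
}.

Section Powers.
Context {k : nat} {V : 'I_k -> pointedType}.

Definition sort_pow (X : seq 'I_k) (n : nat) : seq 'I_k := flatten (nseq n X).

Lemma pt_family_subproof (X : seq 'I_k) (I : Type) (r : seq I) (a : I -> pt V X) :
  map tag (flatten [seq val (a i) | i <- r]) == sort_pow X (size r).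
Proof.
by elim: r => //= i r /eqP IH; rewrite map_cat IH (eqP (valP (a i))).
Qed.

Definition pt_family (X : seq 'I_k) (I : Type) (r : seq I) (a : I -> pt V X) :
    pt V (sort_pow X (size r)) :=
  mk_pt (flatten [seq val (a i) | i <- r]) (pt_family_subproof r a).

End Powers.

(* 2^d and 2^{<d} *)
Definition leaves (d : nat) : seq (d.-tuple bool) := enum {: d.-tuple bool}.

Definition nodes (d : nat) : seq (seq bool) :=
  flatten [seq map val (leaves i) | i <- iota 0 d].

Lemma size_leaves d : size (leaves d) = 2 ^ d.
Proof. by rewrite -cardE card_tuple card_bool. Qed.

Lemma size_nodes d : size (nodes d) = 2 ^ d - 1.
Proof.
elim: d => // d IH; rewrite /nodes -addn1 iotaD map_cat flatten_cat size_cat.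
rewrite -/(nodes d) IH /= cats0 size_map size_leaves add0n addn1 expnS mul2n.
by rewrite -addnn addnBAC // expn_gt0.
Qed.

Section Tree.
Context {k : nat} {V : 'I_k -> pointedType}.

(* For sigma in 2^d and i < d, take i sigma is the restriction of sigma to i. *)
Definition tree (X Y : seq 'I_k) (E : set (pt V (X ++ Y))) (d : nat) :
    set (pt V (sort_pow X (size (leaves d)) ++ sort_pow Y (size (nodes d)))) :=
  [set p | exists (a : d.-tuple bool -> pt V X) (b : seq bool -> pt V Y),
     p = pt_cat (pt_family (leaves d) a) (pt_family (nodes d) b) /\
     forall (sigma : d.-tuple bool) (i : 'I_d),
       E (pt_cat (a sigma) (b (take i sigma))) <-> tnth sigma i = true].

End Tree.

Arguments tree {k V X Y} E d.

Section Stability.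
Context {R : realType} {k : nat} {V : 'I_k -> pointedType}.
Variable G : gradedProbabilitySpace R V.

Definition d_mu_stable (X Y : seq 'I_k) (E : set (pt V (X ++ Y))) (d : nat) :
    Prop :=
  gps_B G E /\ gps_mu G _ (tree E d) = 0%E.

Definition mu_stable (X Y : seq 'I_k) (E : set (pt V (X ++ Y))) : Prop :=
  exists2 d : nat, (1 <= d)%N & d_mu_stable E d.

Definition perfect (X Y : seq 'I_k) (E : set (pt V (X ++ Y))) (A : set (pt V X)) :
    Prop :=
  gps_B G A /\
  \forall b \ae gps_mu G Y,
    gps_mu G X (A `&` fiber_snd E b) = 0%E \/
    gps_mu G X (A `\` fiber_snd E b) = 0%E.

End Stability.

Section FiberAlgebra.
Context {R : realType} {k : nat} {V : 'I_k -> pointedType}.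
Variable G : gradedProbabilitySpace R V.
Variables (W : seq 'I_k) (E : set (pt V W)).

(* Only almost all fibers of a measurable set need be measurable; those that are
   not are left out. *)
Definition fiber_family (I : {set 'I_(size W)}) :
    set (set (pt V (coords (positions I) W))) :=
  [set A | gps_B G A /\
     exists b, A = fiber_at E b \/ A = ~` fiber_at E b].

Definition fiber_boxes (S : seq 'I_k) (N : nat) : set (set (pt V S)) :=
  [set A | exists (J : 'I_N -> {set 'I_(size S)}) (I : 'I_N -> {set 'I_(size W)})
     (e : forall l, coords (positions (J l)) S = coords (positions (I l)) W)
     (B : forall l, set (pt V (coords (positions (I l)) W))),
     (forall l, fiber_family (B l)) /\
     A = [set p | forall l, B l (pt_cast (e l) (pt_coords (positions (J l)) p))]].

Definition fiber_algebra (S : seq 'I_k) : set (set (pt V S)) :=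
  <<s \bigcup_N @fiber_boxes S N >>.

End FiberAlgebra.

Arguments fiber_boxes {R k V} G {W} E S N.
Arguments fiber_algebra {R k V} G {W} E S.

(* Main.v *)
Require Import Defs.
From mathcomp Require Import all_boot all_order all_algebra.
From mathcomp Require Import all_classical all_reals all_analysis.
From mathcomp Require Import measurable_realfun.
From mathcomp Require Import zify.

(* For a relation E on X x Y, call x and x' equivalent when the
   fibers E_x and E_x' agree almost everywhere.  A set of positive measure is
   perfect iff almost all of it lies in one class, so it is enough to show that
   almost every point has a class of positive measure: there are then countably
   many such classes, and since any two of them are separated by some generic
   fiber E_z, each is, up to a null set, an intersection of countably many fibers
   and complements of fibers.

   If E is stable, almost every class has positive measure.  Otherwise let H be
   the set of points with a null class.  A subset of H of positive measure is
   never perfect, so positively many b cut it into two parts of positive measure;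
   iterating, one builds a tree of any given depth that avoids a prescribed null
   set of trees.

   For E on (X x Y) x Z, let f(x,y) be the class of E_(x,y).  By the stable case,
   for almost all x, y, the value f(x,y) is taken by f(x,-) at positively many y',
   and for almost all such y' the value f(x,y') = f(x,y) is taken by f(-,y') at
   positively many x'.  By Fubini the class of (x,y) has positive measure. *)

Set Implicit Arguments.
Unset Strict Implicit.
Unset Printing Implicit Defensive.

Import Order.TTheory GRing.Theory Num.Theory.
Local Open Scope classical_set_scope.

(** * Lists of coordinates and points of product sorts *)

Section Coords.

Lemma coords_iota T m n (s : seq T) : coords (iota m n) s = take n (drop m s).
Proof.
rewrite /coords; elim: n m => [|n IH] m; first by rewrite take0.
rewrite /= IH; have [lems|] := ltnP m (size s).
  case: s IH lems => // x0 s _ lems.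
  by rewrite onthE (nth_map x0)// (drop_nth x0 lems).
by move=> les; rewrite onth_default// /= !drop_oversize// leqW.
Qed.

Lemma coords_cat T u v (s : seq T) : coords (u ++ v) s = coords u s ++ coords v s.
Proof. by rewrite /coords pmap_cat. Qed.

End Coords.

Section Points.
Context {k : nat} {V : 'I_k -> pointedType}.
Implicit Types s X Y Z : seq 'I_k.

Lemma size_val_pt s (p : pt V s) : size (val p) = size s.
Proof. by rewrite -(size_map tag) (eqP (valP p)). Qed.

Lemma val_pt_cast s s' (e : s = s') (p : pt V s) : val (pt_cast e p) = val p.
Proof. by case: s' / e. Qed.

Lemma pt_cat_fst_snd X Y (p : pt V (X ++ Y)) : pt_cat (pt_fst p) (pt_snd p) = p.
Proof. by apply: val_inj; rewrite /= cat_take_drop. Qed.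

Lemma pt_fst_cat X Y (x : pt V X) (y : pt V Y) : pt_fst (pt_cat x y) = x.
Proof. by apply: val_inj; rewrite /= take_size_cat// size_val_pt. Qed.

Lemma pt_snd_cat X Y (x : pt V X) (y : pt V Y) : pt_snd (pt_cat x y) = y.
Proof. by apply: val_inj; rewrite /= drop_size_cat// size_val_pt. Qed.

End Points.

(** * Coordinate maps *)

Section CoordinateMaps.
Context {k : nat} {V : 'I_k -> pointedType}.
Implicit Types s X Y : seq 'I_k.

(** Maps are described by the positions they read in the underlying sequence, so that composites of
    projections and pairings need no transport between equal sorts. *)
Definition coord_map s X (u : seq nat) (f : pt V s -> pt V X) : Prop :=
  forall p, val (f p) = coords u (val p).

Lemma coord_map_id s : coord_map (iota 0 (size s)) (@id (pt V s)).
Proof. by move=> p; rewrite coords_iota drop0 -(size_val_pt p) take_size. Qed.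

Lemma coord_map_fst s X Y m (f : pt V s -> pt V (X ++ Y)) :
  coord_map (iota m (size (X ++ Y))) f ->
  coord_map (iota m (size X)) (fun p => pt_fst (f p)).
Proof.
move=> fm p; have := fm p; rewrite !coords_iota /= => ->.
by rewrite take_takel// size_cat leq_addr.
Qed.

Lemma coord_map_snd s X Y m (f : pt V s -> pt V (X ++ Y)) :
  coord_map (iota m (size (X ++ Y))) f ->
  coord_map (iota (m + size X) (size Y)) (fun p => pt_snd (f p)).
Proof.
move=> fm p; have := fm p; rewrite !coords_iota /= => ->.
by rewrite size_cat addnC -take_drop drop_drop addnC.
Qed.

Lemma coord_map_cat s X Y u v (f : pt V s -> pt V X) (g : pt V s -> pt V Y) :
  coord_map u f -> coord_map v g ->
  coord_map (u ++ v) (fun p => pt_cat (f p) (g p)).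
Proof. by move=> fu gv p; rewrite coords_cat -fu -gv. Qed.

End CoordinateMaps.

(** Discharges the side conditions on a list of positions built from [iota]: no repetition, and all
    positions in range. *)
Ltac iota_lia :=
  rewrite ?cat_uniq ?all_cat ?iota_uniq ?size_cat /=;
  repeat (apply/andP; split);
  rewrite ?iota_uniq //;
  first [ apply/hasPn => ? | apply/allP => ? ];
  rewrite /= ?mem_cat ?mem_iota ?size_cat; lia.

(** * Preimages of measurable sets under coordinate maps *)

Section Measurability.
Context {R : realType} {k : nat} {V : 'I_k -> pointedType}.
Variable G : gradedProbabilitySpace R V.
Implicit Types s t X Y Z : seq 'I_k.

Local Notation gT s := (g_sigma_algebraType (@gps_B _ _ _ G s)).

Lemma gps_measurableP s (A : set (pt V s)) :
  gps_B G A <-> measurable (A : set (gT s)).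
Proof.
have e : (measurable : set (set (gT s))) = @gps_B _ _ _ G s.
  exact: (sigma_algebra_id (gps_sigma_algebra G s)).
by rewrite e.
Qed.

Lemma gps_mu_fst X Y (A : set (pt V X)) : gps_B G A ->
  gps_B G (@pt_fst _ _ X Y @^-1` A) /\
  gps_mu G (X ++ Y) (@pt_fst _ _ X Y @^-1` A) = gps_mu G X A.
Proof.
move=> /gps_measurableP mA.
have mAT : measurable (A `*` setT : set (gT X * gT Y)) by exact: measurableX.
have [B1 mu1] := gps_product mAT.
have eA : [set p | (A `*` setT) (pt_fst p, pt_snd p)] = @pt_fst _ V X Y @^-1` A.
  by apply/seteqP; split=> p //= [].
rewrite eA in B1 mu1; split => //; rewrite mu1 product_measure1E //.
by rewrite [X in (_ * X)%E](_ : _ = 1%E) ?mule1//; exact: probability_setT.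
Qed.

(** The list [u] is completed by the missing positions [w] to a permutation of all positions; the
    preimage of [A] is then a permuted cylinder over [A], covered by [gps_perm] and [gps_mu_fst]. *)
Lemma gps_coords s t (f : pt V s -> pt V t) (u : seq nat) :
  coord_map u f -> uniq u ->
  all [pred i | (i < size s)%N] u ->
  forall A, gps_B G A ->
    gps_B G (f @^-1` A) /\ gps_mu G s (f @^-1` A) = gps_mu G t A.
Proof.
move=> fu uu us A BA.
have et : t = coords u s.
  have := valP (f point); rewrite fu => /eqP <-.
  by rewrite map_coords; congr coords; exact/eqP/(valP (point : pt V s)).
subst t; have -> : f = pt_coords u.
  by apply/funext => p; apply: val_inj; rewrite fu.
pose w := [seq i <- iota 0 (size s) | i \notin u].
have uw : perm_eq (u ++ w) (iota 0 (size s)).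
  apply: uniq_perm; rewrite ?iota_uniq//.
    rewrite cat_uniq uu filter_uniq ?iota_uniq// andbT /=.
    by apply/hasPn => i; rewrite mem_filter => /andP[].
  move=> i; rewrite mem_cat mem_filter; case: (boolP (i \in u)) => //= iu.
  by rewrite mem_iota /= add0n; have /= -> := allP us i iu.
have [B1 mu1] := gps_mu_fst (coords w s) BA.
have e : coords (u ++ w) s = coords u s ++ coords w s by rewrite coords_cat.
(* Stated for a variable sort [t'], so that the equality of sorts can be eliminated. *)
have key t' (e' : t' = coords u s ++ coords w s) :
   gps_B G (fun p => A (pt_fst (pt_cast e' p))) /\
   gps_mu G t' (fun p => A (pt_fst (pt_cast e' p))) = gps_mu G _ A.
  by subst t'.
have [B2 mu2] := key _ e.
have [B3 mu3] := gps_perm uw B2.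
have eA : pt_coords (u ++ w) @^-1` (fun p => A (pt_fst (pt_cast e p))) =
          pt_coords u @^-1` A.
  apply/funext => p /=; congr A; apply: val_inj => /=.
  rewrite val_pt_cast /= coords_cat take_size_cat//.
  by rewrite -(size_map tag) map_coords (eqP (valP p)).
by rewrite eA in B3 mu3; rewrite mu3 mu2.
Qed.

End Measurability.

(** * Almost everywhere quantifiers *)

Section AlmostEverywhere.
Context {R : realType} {k : nat} {V : 'I_k -> pointedType}.
Variable G : gradedProbabilitySpace R V.
Implicit Types s t X Y Z : seq 'I_k.

Local Notation gT s := (g_sigma_algebraType (@gps_B _ _ _ G s)).

Definition ae s (P : pt V s -> Prop) : Prop := \forall p \ae gps_mu G s, P p.

(* Measurability for the completion of the measure: unlike gps_B, it is stable
   under almost everywhere quantification over a coordinate (fubini_snd), since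
   only almost all fibers of a measurable set are measurable. *)
Definition ae_measurable s (S : pt V s -> Prop) : Prop :=
  exists2 M : set (pt V s), gps_B G M & ae (fun p => M p <-> S p).

Lemma ae_all s (P : pt V s -> Prop) : (forall p, P p) -> ae P.
Proof. exact: (aeW (gps_mu G s)). Qed.

Lemma ae_mono s (P Q : pt V s -> Prop) : (forall p, P p -> Q p) -> ae P -> ae Q.
Proof. exact: (@filterS _ _ (ae_filter_ringOfSetsType (gps_mu G s))). Qed.

Lemma ae_and s (P Q : pt V s -> Prop) : ae P -> ae Q -> ae (fun p => P p /\ Q p).
Proof. exact: (@filterI _ _ (ae_filter_ringOfSetsType (gps_mu G s))). Qed.

Lemma ae_mono2 s (P Q S : pt V s -> Prop) :
  (forall p, P p -> Q p -> S p) -> ae P -> ae Q -> ae S.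
Proof. exact: (@filterS2 _ _ (ae_filter_ringOfSetsType (gps_mu G s))). Qed.

Lemma ae_forall_nat s (P : nat -> pt V s -> Prop) :
  (forall n, ae (P n)) -> ae (fun p => forall n, P n p).
Proof. exact: (ae_foralln (mu := gps_mu G s)). Qed.

Lemma ae_not_set0 s (A : set (pt V s)) : gps_B G A ->
  ae (fun p => ~ A p) <-> gps_mu G s A = 0%E.
Proof.
move=> /gps_measurableP mA.
rewrite -(negligibleP (gps_mu G s) mA).
by rewrite /ae /prop_near1 /nbhs /= /almost_everywhere setCK.
Qed.

Lemma ae_exists s (P : pt V s -> Prop) : ae P -> exists p, P p.
Proof.
move=> aeP; apply: contrapT => /forallNP nP.
have : ae (fun p : pt V s => ~ (setT : set (pt V s)) p).
  by apply: ae_mono aeP => p /nP.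
rewrite ae_not_set0; last by apply/gps_measurableP; exact: measurableT.
by rewrite (probability_setT (gps_mu G s)) => /eqP; rewrite onee_eq0.
Qed.

(** [~ ae (fun p => ~ P p)] says that [P] is not negligible; it stands for positive measure
    throughout, and makes sense for predicates outside the sigma-algebra. *)
Lemma nonnull_exists s (P Q : pt V s -> Prop) :
  ~ ae (fun p => ~ P p) -> ae Q -> exists p, P p /\ Q p.
Proof.
move=> nP aQ; apply: contrapT => /forallNP nPQ; apply: nP.
by apply: ae_mono aQ => p Qp Pp; apply: (nPQ p).
Qed.

Lemma nonnull_mono s (P Q : pt V s -> Prop) : ae (fun p => P p -> Q p) ->
  ~ ae (fun p => ~ P p) -> ~ ae (fun p => ~ Q p).
Proof.
by move=> PQ; apply: contra_not; apply: ae_mono2 PQ => p + nQ Pp; move/(_ Pp).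
Qed.

Lemma ae_preimage s t (f : pt V s -> pt V t) (u : seq nat) (P : pt V t -> Prop) :
  coord_map u f -> uniq u ->
  all [pred i | (i < size s)%N] u -> ae P -> ae (fun p => P (f p)).
Proof.
move=> fu uu us [N [mN N0 PN]].
have [B0 mu0] := gps_coords fu uu us ((gps_measurableP G N).2 mN).
exists (f @^-1` N); split; [exact/gps_measurableP|by rewrite mu0|].
by move=> p /= nP; exact: PN.
Qed.

Lemma ae_measurable_B s (A : set (pt V s)) : gps_B G A -> ae_measurable A.
Proof. by move=> BA; exists A => //; apply: ae_all. Qed.

Lemma ae_measurable_ae s (P : pt V s -> Prop) : ae P -> ae_measurable P.
Proof.
move=> aP; exists setT; first by apply/gps_measurableP; exact: measurableT.
by apply: ae_mono aP => p.
Qed.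

Lemma ae_measurable_eq s (P Q : pt V s -> Prop) :
  ae (fun p => P p <-> Q p) -> ae_measurable P -> ae_measurable Q.
Proof.
move=> PQ [M BM MP]; exists M => //.
by apply: ae_mono2 MP PQ => p ? ?; tauto.
Qed.

Lemma ae_measurable_not s (P : pt V s -> Prop) :
  ae_measurable P -> ae_measurable (fun p => ~ P p).
Proof.
move=> [M /gps_measurableP BM MP]; exists (~` M).
  by apply/gps_measurableP; exact: measurableC.
by apply: ae_mono MP => p /=; tauto.
Qed.

Lemma ae_measurable_and s (P Q : pt V s -> Prop) :
  ae_measurable P -> ae_measurable Q -> ae_measurable (fun p => P p /\ Q p).
Proof.
move=> [M /gps_measurableP BM MP] [N /gps_measurableP BN NQ].
exists (M `&` N); first by apply/gps_measurableP; exact: measurableI.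
by apply: ae_mono2 MP NQ => p /=; rewrite /setI /=; tauto.
Qed.

Lemma ae_measurable_imply s (P Q : pt V s -> Prop) :
  ae_measurable P -> ae_measurable Q -> ae_measurable (fun p => P p -> Q p).
Proof.
move=> mP mQ.
apply: (ae_measurable_eq (P := fun p => ~ (P p /\ ~ Q p))).
  apply: ae_all => p; split => [nPQ Pp|PQ [/PQ]//].
  by apply: contrapT => nQ; apply: nPQ.
by apply/ae_measurable_not/ae_measurable_and => //; exact: ae_measurable_not.
Qed.

Lemma ae_measurable_iff s (P Q : pt V s -> Prop) :
  ae_measurable P -> ae_measurable Q -> ae_measurable (fun p => P p <-> Q p).
Proof.
by move=> mP mQ; apply: ae_measurable_and; apply: ae_measurable_imply.
Qed.

Lemma ae_measurable_preimage s t (f : pt V s -> pt V t) (u : seq nat)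
    (P : pt V t -> Prop) :
  coord_map u f -> uniq u ->
  all [pred i | (i < size s)%N] u ->
  ae_measurable P -> ae_measurable (fun p => P (f p)).
Proof.
move=> fu uu us [M BM MP]; exists (f @^-1` M).
  by have [] := gps_coords fu uu us BM.
exact: ae_preimage fu uu us MP.
Qed.

(** The function [f] of [gps_fubini] is almost everywhere the measure of the fiber, and an almost
    everywhere nonnegative function has integral zero iff it vanishes almost everywhere. *)
Lemma fubini_B X Y (A : set (pt V (X ++ Y))) : gps_B G A ->
  [/\ ae (fun y => gps_B G (fiber_snd A y)),
      ae_measurable (fun y => ae (fun x => ~ A (pt_cat x y))) &
      ae (fun p => ~ A p) <-> ae (fun y => ae (fun x => ~ A (pt_cat x y)))].
Proof.
move=> BA; have [f [mf fA muA]] := gps_fubini BA.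
have f0 : ae (fun y => f y = 0%E <-> ae (fun x => ~ A (pt_cat x y))).
  by apply: ae_mono fA => y [By ->]; rewrite -(ae_not_set0 By).
have BAy : ae (fun y => gps_B G (fiber_snd A y)).
  by apply: ae_mono fA => y [].
split => //.
  exists (f @^-1` [set 0%E]) => //.
  by apply/gps_measurableP; rewrite -[X in measurable X]setTI; exact: mf.
rewrite ae_not_set0 // muA.
(* [f] is nonnegative only almost everywhere, and the criterion for a zero integral concerns the
   absolute value. *)
have -> : (\int[gps_mu G Y]_y f y = \int[gps_mu G Y]_y `|f y|)%E.
  apply: ae_eq_integral => //; first exact: measurableT_comp.
  by apply: ae_mono fA => y [_ fy] _; rewrite fy gee0_abs.
rewrite ae_eq_integral_abs //; split.
  by move=> h; apply: ae_mono2 h f0 => y /(_ I) /= fy0 <-.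
by move=> h; apply: ae_mono2 h f0 => y fy0 [_ +] _; exact.
Qed.

Lemma ae_ae_snd X Y (P : pt V (X ++ Y) -> Prop) :
  ae P -> ae (fun y => ae (fun x => P (pt_cat x y))).
Proof.
move=> [N [mN N0 PN]]; have BN := (gps_measurableP G N).2 mN.
have [_ _ [+ _]] := fubini_B BN.
move=> /(_ ((ae_not_set0 BN).2 N0)); apply: ae_mono => y; apply: ae_mono => x nN.
by apply: contrapT => nP; apply: nN; exact: PN.
Qed.

(** [P] is replaced by a measurable set [M] equal to it almost everywhere; [fubini_B], which is
    about null sets, is applied to the complement of [M]. *)
Lemma fubini_snd X Y (P : pt V (X ++ Y) -> Prop) : ae_measurable P ->
  [/\ ae (fun y => ae_measurable (fun x => P (pt_cat x y))),
      ae_measurable (fun y => ae (fun x => P (pt_cat x y))) &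
      ae P <-> ae (fun y => ae (fun x => P (pt_cat x y)))].
Proof.
move=> [M /gps_measurableP mM MP].
have BCM : gps_B G (~` M) by apply/gps_measurableP; exact: measurableC.
have [h1 h2 h3] := fubini_B BCM.
have MPy := ae_ae_snd MP.
have e : ae (fun y => ae (fun x => ~ (~` M) (pt_cat x y)) <->
                      ae (fun x => P (pt_cat x y))).
  apply: ae_mono MPy => y MPy; split; apply: ae_mono2 MPy => x;
    rewrite /setC /= notK; tauto.
split.
- apply: ae_mono2 h1 MPy => y /gps_measurableP By MPy.
  exists (~` (fiber_snd (~` M) y)); first by apply/gps_measurableP; exact: measurableC.
  by apply: ae_mono MPy => x; rewrite /fiber_snd /= notK.
- exact: ae_measurable_eq e h2.
- have -> : ae P <-> ae (fun p => ~ (~` M) p).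
    by split; apply: ae_mono2 MP => x; rewrite /setC /= notK; tauto.
  rewrite h3; split => h.
    by apply: ae_mono2 h e => y ? [+ _]; exact.
  by apply: ae_mono2 h e => y ? [_ +]; exact.
Qed.

Definition pt_swap X Y (p : pt V (X ++ Y)) : pt V (Y ++ X) :=
  pt_cat (pt_snd p) (pt_fst p).

Lemma coord_map_swap X Y :
  coord_map (iota (0 + size X) (size Y) ++ iota 0 (size X)) (@pt_swap X Y).
Proof.
have idm := @coord_map_id _ V (X ++ Y).
exact: coord_map_cat (coord_map_snd idm) (coord_map_fst idm).
Qed.

Lemma ae_swap X Y (P : pt V (Y ++ X) -> Prop) :
  ae P -> ae (fun p : pt V (X ++ Y) => P (pt_swap p)).
Proof. by apply: (ae_preimage (@coord_map_swap X Y)); iota_lia. Qed.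

Lemma ae_measurable_swap X Y (P : pt V (Y ++ X) -> Prop) :
  ae_measurable P -> ae_measurable (fun p : pt V (X ++ Y) => P (pt_swap p)).
Proof. by apply: (ae_measurable_preimage (@coord_map_swap X Y)); iota_lia. Qed.

Lemma pt_swap_cat X Y (x : pt V X) (y : pt V Y) : pt_swap (pt_cat x y) = pt_cat y x.
Proof. by rewrite /pt_swap pt_fst_cat pt_snd_cat. Qed.

Lemma pt_swapK X Y (p : pt V (X ++ Y)) : pt_swap (pt_swap p) = p.
Proof. by rewrite {2}/pt_swap pt_swap_cat pt_cat_fst_snd. Qed.

Lemma fubini_fst X Y (P : pt V (X ++ Y) -> Prop) : ae_measurable P ->
  [/\ ae (fun x => ae_measurable (fun y => P (pt_cat x y))),
      ae_measurable (fun x => ae (fun y => P (pt_cat x y))) &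
      ae P <-> ae (fun x => ae (fun y => P (pt_cat x y)))].
Proof.
have swapE x : (fun y : pt V Y => P (pt_swap (pt_cat y x))) =
               (fun y => P (pt_cat x y)).
  by apply/funext => y; rewrite pt_swap_cat.
move=> /ae_measurable_swap /fubini_snd [h1 h2 h3].
have e : ae P <-> ae (fun p : pt V (Y ++ X) => P (pt_swap p)).
  split=> /ae_swap //.
  by rewrite (_ : (fun p => _) = P)//; apply/funext => p; rewrite pt_swapK.
split; last by rewrite e h3; split; apply: ae_mono => x; rewrite swapE.
  by apply: ae_mono h1 => x; rewrite swapE.
by apply: ae_measurable_eq h2; apply: ae_all => x; rewrite swapE.
Qed.

Lemma fubini_swap X Y (P : pt V (X ++ Y) -> Prop) : ae_measurable P ->
  ae (fun x => ae (fun y => P (pt_cat x y))) <->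
  ae (fun y => ae (fun x => P (pt_cat x y))).
Proof. by move=> mP; have [_ _ <-] := fubini_fst mP; have [_ _ <-] := fubini_snd mP. Qed.

End AlmostEverywhere.

(** * Stable relations *)

Section Families.
Context {k : nat} {V : 'I_k -> pointedType}.
Implicit Types X Y : seq 'I_k.

(** Recovers the components of a [pt_family]; [point] is a default for indices out of range. *)
Fixpoint block X n : pt V (sort_pow X n) -> nat -> pt V X :=
  match n return pt V (sort_pow X n) -> nat -> pt V X with
  | 0 => fun _ _ => point
  | n'.+1 => fun p j =>
      if j is j'.+1 then block (@pt_snd _ V X (sort_pow X n') p) j'
      else @pt_fst _ V X (sort_pow X n') p
  end.

Lemma val_block X n (p : pt V (sort_pow X n)) j : (j < n)%N ->
  val (block p j) = take (size X) (drop (j * size X) (val p)).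
Proof.
elim: n p j => // n IH p [|j] /= jn; first by rewrite drop0.
by rewrite IH//= drop_drop mulSn addnC.
Qed.

Lemma pt_family_cons (I : Type) X i (r : seq I) (a : I -> pt V X) :
  pt_family (i :: r) a = pt_cat (a i) (pt_family r a).
Proof. exact: val_inj. Qed.

Lemma eq_in_pt_family (I : eqType) X (r : seq I) (a a' : I -> pt V X) :
  {in r, a =1 a'} -> pt_family r a = pt_family r a'.
Proof.
move=> aa'; apply: val_inj => /=; congr flatten.
by apply/eq_in_map => i ir; rewrite aa'.
Qed.

Lemma block_pt_family (I : eqType) X (r : seq I) (a : I -> pt V X) i :
  i \in r -> block (pt_family r a) (index i r) = a i.
Proof.
elim: r => //= j r IH; rewrite inE (eq_sym i j) pt_family_cons.
have [->|ji] /= := eqVneq j i; first by rewrite pt_fst_cat.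
by move=> /IH <-; rewrite pt_snd_cat.
Qed.

Lemma pt_family_block (I : eqType) X (r : seq I) (p : pt V (sort_pow X (size r))) :
  uniq r -> pt_family r (fun i => block p (index i r)) = p.
Proof.
elim: r p => [|i r IH] p /=.
  by move=> _; apply: val_inj => /=; apply/esym/size0nil; rewrite size_val_pt.
move=> /andP[ir ur]; rewrite pt_family_cons /= eqxx.
rewrite -[RHS](@pt_cat_fst_snd _ _ X (sort_pow X (size r)) p); congr pt_cat.
rewrite -[RHS]IH//; apply: eq_in_pt_family => j jr.
by case: eqP => [ij|//]; rewrite ij jr in ir.
Qed.

Lemma mem_nodes d s : (s \in nodes d) = (size s < d)%N.
Proof.
apply/flattenP/idP => [[_ /mapP[i + ->] /mapP[t _ ->]]|sd].
  by rewrite mem_iota size_tuple.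
exists (map val (leaves (size s))); first by apply: map_f; rewrite mem_iota.
apply/mapP; exists (in_tuple s) => //.
by rewrite mem_enum.
Qed.

Lemma nodesS d : nodes d.+1 = nodes d ++ map val (leaves d).
Proof. by rewrite /nodes -addn1 iotaD map_cat flatten_cat /= cats0. Qed.

Lemma uniq_leaves d : uniq (leaves d).
Proof. exact: enum_uniq. Qed.

Lemma mem_leaves d s : s \in leaves d.
Proof. by rewrite mem_enum. Qed.

Lemma uniq_nodes d : uniq (nodes d).
Proof.
elim: d => // d IH; rewrite nodesS cat_uniq IH map_inj_uniq ?uniq_leaves ?andbT.
  by apply/hasPn => _ /mapP[t _ ->]; rewrite mem_nodes size_tuple ltnn.
exact: val_inj.
Qed.

(** Labelling the nodes in this order reaches each node after all its proper initial segments. *)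
Lemma nodes_sorted d : pairwise (fun s t => size s <= size t)%N (nodes d).
Proof.
elim: d => // d IH; rewrite nodesS pairwise_cat IH /=; apply/andP; split.
  apply/allrelP => s _ + /mapP[t _ ->]; rewrite mem_nodes size_tuple; exact: ltnW.
rewrite pairwise_map; apply/(pairwiseP (nseq_tuple d true)) => i j _ _ _ /=.
by rewrite !size_tuple.
Qed.

End Families.

(** * Measurability of the set of trees, and choice of labels outside a null set *)

Section Trees.
Context {R : realType} {k : nat} {V : 'I_k -> pointedType}.
Variable G : gradedProbabilitySpace R V.
Implicit Types X Y Z : seq 'I_k.

(** The set of trees is a finite intersection of preimages of [E], or of their complements, under
    the maps reading one leaf and one node. *)
Lemma tree_B X Y (E : set (pt V (X ++ Y))) d : gps_B G E -> gps_B G (tree E d).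
Proof.
move=> BE.
pose F (sigma : d.-tuple bool) (i : 'I_d) : set (pt V _) :=
  [set p : pt V (sort_pow X (size (leaves d)) ++ sort_pow Y (size (nodes d))) |
    E (pt_cat (block (pt_fst p) (index sigma (leaves d)))
              (block (pt_snd p) (index (take i sigma : seq bool) (nodes d))))].
have BF sigma i : gps_B G (F sigma i).
  set j := index sigma (leaves d).
  set l := index (take i sigma : seq bool) (nodes d).
  have jd : (j < size (leaves d))%N by rewrite index_mem mem_leaves.
  have ld : (l < size (nodes d))%N.
    by rewrite index_mem mem_nodes size_take size_tuple !ltn_ord.
  pose n := size (sort_pow X (size (leaves d))).
  pose u := iota (j * size X) (size X) ++ iota (n + l * size Y) (size Y).
  have sp W m : size (sort_pow W m) = (m * size W)%N.
    by elim: m => //= m IH; rewrite size_cat IH mulSn.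
  have jn : (j * size X + size X <= n)%N.
    by rewrite /n sp addnC -mulSn leq_mul2r jd orbT.
  have ln : (l * size Y + size Y <= size (sort_pow Y (size (nodes d))))%N.
    by rewrite sp addnC -mulSn leq_mul2r ld orbT.
  apply: (proj1 (gps_coords (u := u) _ _ _ BE)).
  - move=> p /=; rewrite coords_cat !coords_iota !val_block//=; congr (_ ++ _).
      by rewrite take_drop take_takel -?take_drop// addnC.
    by rewrite drop_drop addnC.
  - rewrite cat_uniq !iota_uniq andbT /=; apply/hasPn => x.
    by rewrite !mem_iota; lia.
  - rewrite all_cat size_cat; apply/andP; split; apply/allP => x;
      rewrite mem_iota /= -/n; lia.
have -> : tree E d = \bigcap_(s in [set: d.-tuple bool])
   \bigcap_(i in [set: 'I_d]) (if tnth s i then F s i else ~` F s i).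
  apply/seteqP; split=> p.
    move=> [a [b [-> ab]]] s _ i _.
    have FE : F s i (pt_cat (pt_family (leaves d) a) (pt_family (nodes d) b)) <->
              E (pt_cat (a s) (b (take i s))).
      rewrite /F /= pt_fst_cat pt_snd_cat !block_pt_family ?mem_leaves//.
      by rewrite mem_nodes size_take size_tuple !ltn_ord.
    by case: ifP => si; [apply/FE/ab|move=> /FE/ab; rewrite si].
  move=> Fp; rewrite /tree/=; exists (fun s => block (pt_fst p) (index s (leaves d))).
  exists (fun s => block (pt_snd p) (index s (nodes d))); split.
    by rewrite !pt_family_block ?uniq_leaves ?uniq_nodes// pt_cat_fst_snd.
  move=> s i; have := Fp s I i I; rewrite /F; case: ifP => _ //=.
apply/gps_measurableP; apply: fin_bigcap_measurable => // s _.
apply: fin_bigcap_measurable => // i _.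
have /gps_measurableP mF := BF s i.
by case: ifP => _ //; exact: measurableC.
Qed.

(* A null set of families is avoided by choosing the coordinates one after the
   other, each from a set of positive measure. *)
Lemma choose_family (I : eqType) Y (inv : seq I -> (I -> pt V Y) -> Prop)
    (r r0 : seq I) (Q : pt V (sort_pow Y (size r)) -> Prop) (b0 : I -> pt V Y) :
  uniq (r0 ++ r) -> inv r0 b0 -> ae G Q ->
  (forall r1 i r2 b, r0 ++ r = r1 ++ i :: r2 -> inv r1 b ->
    ~ ae G (fun y => ~ inv (rcons r1 i) [eta b with i |-> y])) ->
  exists b, [/\ inv (r0 ++ r) b, Q (pt_family r b) & {in r0, b =1 b0}].
Proof.
elim: r r0 Q b0 => [|i r IH] r0 Q b0 ur inv0 aQ step.
  rewrite cats0; exists b0; split => //.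
  have [q] := ae_exists aQ; rewrite (_ : q = pt_family [::] b0)//.
  by apply: val_inj => /=; apply: size0nil; rewrite size_val_pt.
have [_ _ [+ _]] := @fubini_fst _ _ _ G Y (sort_pow Y (size r)) _
   (ae_measurable_ae aQ).
move=> /(_ aQ) aQ'.
have [y [invy Qy]] := nonnull_exists (step r0 i r b0 erefl inv0) aQ'.
have ur' : uniq (rcons r0 i ++ r) by rewrite cat_rcons.
have [|b [invb Qb bb]] := IH (rcons r0 i) _ _ ur' invy Qy.
  by rewrite cat_rcons.
exists b; split; first by rewrite -cat_rcons.
  by rewrite pt_family_cons bb ?mem_rcons ?mem_head//= eqxx.
move=> j jr0; rewrite bb ?mem_rcons ?inE ?jr0 ?orbT//=.
case: eqP => // ji; move: ur; rewrite cat_uniq /= -ji jr0.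
by rewrite /= andbF.
Qed.

End Trees.

(** * Classes of points with almost equal fibers, and their positive measure under stability *)

Section StableRelations.
Context {R : realType} {k : nat} {V : 'I_k -> pointedType}.
Variable G : gradedProbabilitySpace R V.
Implicit Types X Y Z : seq 'I_k.

Definition same_fiber X Y (E : set (pt V (X ++ Y))) (x' x : pt V X) : Prop :=
  ae G (fun y => E (pt_cat x' y) <-> E (pt_cat x y)).

Lemma ae_measurable_fst X Y (P : pt V X -> Prop) :
  ae_measurable G P -> ae_measurable G (fun p : pt V (X ++ Y) => P (pt_fst p)).
Proof.
by apply: (ae_measurable_preimage (coord_map_fst (@coord_map_id _ V (X ++ Y))));
  iota_lia.
Qed.

Lemma ae_measurable_snd X Y (P : pt V Y -> Prop) :
  ae_measurable G P -> ae_measurable G (fun p : pt V (X ++ Y) => P (pt_snd p)).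
Proof.
by apply: (ae_measurable_preimage (coord_map_snd (@coord_map_id _ V (X ++ Y))));
  iota_lia.
Qed.

Lemma ae_measurable_same_fiber X Y (E : set (pt V (X ++ Y))) : gps_B G E ->
  ae_measurable G (fun q : pt V (X ++ X) => same_fiber E (pt_fst q) (pt_snd q)).
Proof.
move=> BE; have mE := ae_measurable_B BE.
have idm := @coord_map_id _ V ((X ++ X) ++ Y).
have c1 := coord_map_cat (coord_map_fst (coord_map_fst idm)) (coord_map_snd idm).
have c2 := coord_map_cat (coord_map_snd (coord_map_fst idm)) (coord_map_snd idm).
have m1 := ae_measurable_preimage c1 _ _ mE.
have m2 := ae_measurable_preimage c2 _ _ mE.
have [||||_ h _] := fubini_fst (ae_measurable_iff (m1 _ _) (m2 _ _)); try iota_lia.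
apply: ae_measurable_eq h; apply: ae_all => q; rewrite /same_fiber.
by split; apply: ae_mono => y; rewrite !pt_fst_cat !pt_snd_cat.
Qed.

Lemma ae_measurable_atom X Y (E : set (pt V (X ++ Y))) : gps_B G E ->
  ae_measurable G (fun x => ae G (fun x' => ~ same_fiber E x' x)).
Proof.
move=> /ae_measurable_same_fiber /ae_measurable_not /fubini_snd [_ h _].
apply: ae_measurable_eq h; apply: ae_all => x.
by split; apply: ae_mono => x'; rewrite pt_fst_cat pt_snd_cat.
Qed.

(** Otherwise, for almost every [y], membership in the fiber over [y] is almost constant on [A],
    with value [v y]. By Fubini almost every point of [A] has a fiber almost equal to [v], so almost
    all of [A] lies in a single class, which is null. *)
Lemma nonatomic_split X Y (E : set (pt V (X ++ Y))) (A : pt V X -> Prop) :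
  gps_B G E -> ae_measurable G A -> ~ ae G (fun x => ~ A x) ->
  (forall x, A x -> ae G (fun x' => ~ same_fiber E x' x)) ->
  ~ ae G (fun y => ~ [/\ ae_measurable G (fun x => E (pt_cat x y)),
    ~ ae G (fun x => ~ (A x /\ E (pt_cat x y))) &
    ~ ae G (fun x => ~ (A x /\ ~ E (pt_cat x y)))]).
Proof.
move=> BE mA nA AH nsplit.
have mE := ae_measurable_B BE.
pose v y := ae G (fun x => A x -> E (pt_cat x y)).
have mv : ae_measurable G v.
  have [_ h _] := fubini_snd (ae_measurable_imply (@ae_measurable_fst X Y A mA) mE).
  apply: ae_measurable_eq h; apply: ae_all => y.
  by split; apply: ae_mono => x; rewrite pt_fst_cat.
have vE : ae G (fun y => ae G (fun x => A x -> (E (pt_cat x y) <-> v y))).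
  have [mEy _ _] := fubini_snd mE.
  apply: ae_mono2 nsplit mEy => y /not_and3P ns mEy.
  case: ns => [|/contrapT AE|/contrapT AnE]; first by [].
    have nv : ~ v y.
      by move=> vy; apply: nA; apply: ae_mono2 AE vy => x; tauto.
    by apply: ae_mono AE => x; tauto.
  have vy : v y by apply: ae_mono AnE => x nAE Ax; apply: contrapT => nE; tauto.
  by move: (vy); apply: ae_mono => x; tauto.
have mAE : ae_measurable G (fun p : pt V (X ++ Y) =>
    A (pt_fst p) -> (E p <-> v (pt_snd p))).
  apply: ae_measurable_imply; first exact: ae_measurable_fst.
  by apply: ae_measurable_iff => //; exact: ae_measurable_snd.
have T : ae G (fun x => A x -> ae G (fun y => E (pt_cat x y) <-> v y)).
  have [_ /(_ _)Av] := fubini_swap mAE.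
  apply: ae_mono (Av _) => [x {}Av Ax|].
    by apply: ae_mono Av => y; rewrite pt_fst_cat pt_snd_cat; exact.
  by apply: ae_mono vE => y; apply: ae_mono => x; rewrite pt_fst_cat pt_snd_cat.
(* The class of this [x] contains almost all of [A]. *)
have [x [Ax /(_ Ax) Tx]] := nonnull_exists nA T.
apply: nA; apply: ae_mono2 T (AH x Ax) => x' Tx' nsame Ax'; apply: nsame.
by apply: ae_mono2 (Tx' Ax') Tx => y; tauto.
Qed.

(** If the set [H] of points with a null class were not null, labels could be chosen one by one to
    form a tree outside the null set of trees: first the nodes, by increasing length, each splitting
    the set at the end of its branch by [nonatomic_split], then the leaves. *)
Lemma stable_atomic X Y (E : set (pt V (X ++ Y))) d :
  gps_B G E -> gps_mu G _ (tree E d) = 0%E ->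
  ae G (fun x => ~ ae G (fun x' => ~ same_fiber E x' x)).
Proof.
move=> BE tree0; apply: contrapT => nH.
pose H x := ae G (fun x' => ~ same_fiber E x' x).
have mH : ae_measurable G H := ae_measurable_atom BE.
(* The points of H at the end of the branch t when the nodes are labelled by b. *)
pose A (t : seq bool) (b : seq bool -> pt V Y) x :=
  H x /\ forall i, (i < size t)%N ->
    (E (pt_cat x (b (take i t))) <-> nth false t i = true).
(* Once the nodes in [r0] are labelled, every branch running only through them ends in a set of
   positive measure. *)
pose inv (r0 : seq (seq bool)) b := forall t,
  (forall i, (i < size t)%N -> take i t \in r0) ->
  ae_measurable G (A t b) /\ ~ ae G (fun x => ~ A t b x).
have ntree : ae G (fun p => ~ tree E d p).
  by apply/ae_not_set0 => //; exact: tree_B.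
(* Fubini in this order: for almost all node labels, almost all leaf labels avoid the trees. So the
   nodes come first. *)
have [_ _ [+ _]] := fubini_snd (ae_measurable_ae ntree) => /(_ ntree) ntree'.
have [|r1 n r2 b nE invb|b [invb Qb _]] :=
    choose_family (inv := inv) (b0 := fun=> point)
      (uniq_nodes d : uniq ([::] ++ _)) _ ntree'.
(* With no node labelled, only the empty branch counts, and its set is [H]. *)
- move=> [|c t /(_ 0%N isT)//] _.
  have AH x : A [::] (fun=> point) x <-> H x by split=> [[]//|Hx]; split.
  split; first by apply: ae_measurable_eq mH; apply: ae_all => x; rewrite AH.
  by apply: contra_not nH; apply: ae_mono => x nA; rewrite -[~ _]/(~ H x) -AH.
- rewrite /= in nE; have := nodes_sorted d; rewrite nE.
  rewrite pairwise_cat /= => /and3P[/allrelP r1n _].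
  move=> /andP[/allP r2n _].
  have size_r1 t : t \in r1 -> (size t <= size n)%N.
    by move=> tr1; apply: r1n => //; exact: mem_head.
  have size_n : (size n < d)%N by rewrite -mem_nodes nE mem_cat mem_head orbT.
  have n_r1 i : (i < size n)%N -> take i n \in r1.
    move=> il; have : take i n \in nodes d.
      by rewrite mem_nodes size_takel ?(ltnW il)//; lia.
    rewrite nE mem_cat => /orP[//|]; rewrite inE => /orP[/eqP/(congr1 size)|/r2n].
      by rewrite size_takel ?(ltnW il)//; lia.
    by rewrite /= size_takel ?(ltnW il)// leqNgt il.
  have [mA nA] := invb n n_r1.
  apply: nonnull_mono (nonatomic_split BE mA nA _); last by move=> x [].
  apply: ae_all => y [mEy nAE nAnE] t tr.
  (* Either [t] passes through the new node [n], and its set is one of the two halves of [A n b] cut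
     by [y], or the new label does not affect it. *)
  have [[j [jt tj]]|no] := pselect (exists j, (j < size t)%N /\ take j t = n).
    have jn : j = size n by rewrite -tj size_takel// ltnW.
    (* A longer [t] would have a labelled initial segment longer than [n], against the order of the
       nodes. *)
    have size_t : size t = j.+1.
      apply/eqP; rewrite eqn_leq jt andbT leqNgt; apply/negP => jt'.
      have := tr _ jt'; rewrite mem_rcons inE => /orP[/eqP/(congr1 size)|/size_r1];
        rewrite size_takel; lia.
    have AE x : A t [eta b with n |-> y] x <->
        A n b x /\ (E (pt_cat x y) <-> nth false t j = true).
      have upd i : (i < j)%N -> [eta b with n |-> y] (take i t) = b (take i n).
        move=> ij; rewrite -tj take_takel 1?ltnW//=; case: eqP => // /(congr1 size).
        by rewrite !size_takel; lia.
      have nth_t i : (i < j)%N -> nth false t i = nth false n i.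
        by move=> ij; rewrite -tj nth_take.
      split=> [[Hx Ex]|[[Hx Ex] Exy]].
        split; last by have := Ex j jt; rewrite /= tj eqxx.
        split=> // i; rewrite -jn => ij; rewrite -upd// -nth_t//.
        by apply: Ex; rewrite size_t ltnW.
      split=> // i; rewrite size_t ltnS leq_eqVlt => /orP[/eqP->|ij].
        by rewrite /= tj eqxx.
      by rewrite upd// nth_t//; apply: Ex; rewrite -jn.
    have mAE : ae_measurable G (fun x => A n b x /\
        (E (pt_cat x y) <-> nth false t j = true)).
      apply: ae_measurable_and => //; apply: ae_measurable_iff => //.
      case: (nth _ _ _); first by apply: ae_measurable_ae; exact: ae_all.
      apply: (ae_measurable_eq (P := fun=> ~ True)); first exact: ae_all.
      by apply: ae_measurable_not; apply: ae_measurable_ae; exact: ae_all.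
    split; first by apply: ae_measurable_eq mAE; apply: ae_all => x; rewrite AE.
    case: (nth _ _ _) AE => AE.
      by apply: contra_not nAE; apply: ae_mono => x; rewrite AE; tauto.
    apply: contra_not nAnE; apply: ae_mono => x; rewrite AE.
    by move=> + [Ax nE']; apply; split.
  have tr1 i : (i < size t)%N -> take i t \in r1.
    move=> it; have := tr i it; rewrite mem_rcons inE => /orP[/eqP tn|//].
    by exfalso; apply: no; exists i.
  have AE x : A t [eta b with n |-> y] x <-> A t b x.
    have upd i : (i < size t)%N -> [eta b with n |-> y] (take i t) = b (take i t).
      by move=> it /=; case: eqP => // tn; exfalso; apply: no; exists i.
    by split=> [] [Hx Ex]; split=> // i it; have := Ex i it; rewrite upd.
  have [mAt nAt] := invb t tr1.
  split; first by apply: ae_measurable_eq mAt; apply: ae_all => x; rewrite AE.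
  by apply: contra_not nAt; apply: ae_mono => x; rewrite AE.
(* Each leaf is now labelled by a point of the set at the end of its branch; the result is a tree
   that [Qa] excludes. *)
have [|r1 s r2 a _ inva|a [inva Qa _]] := choose_family
    (inv := fun (r0 : seq (d.-tuple bool)) a => forall s : d.-tuple bool,
       s \in r0 -> A s b (a s))
    (b0 := fun=> point) (uniq_leaves d : uniq ([::] ++ _)) _ Qb.
- by [].
- have [_ nA] : ae_measurable G (A s b) /\ ~ ae G (fun x => ~ A s b x).
    by apply: invb => i; rewrite size_tuple => id;
      rewrite mem_nodes size_takel ?size_tuple// ltnW.
  apply: nonnull_mono nA; apply: ae_all => x Ax s' /=.
  by rewrite mem_rcons inE; case: eqP => [->//|_ /=]; exact: inva.
apply: Qa; exists a, b; split => // s i.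
have [_ /(_ i)] := inva s (mem_leaves s).
by rewrite size_tuple (tnth_nth false); apply.
Qed.

End StableRelations.

(** * Partition into perfect sets *)

(** For each [n] only finitely many indices have measure above 1/(n+1): from an infinite supply,
    [n.+1] sets made disjoint at no cost in measure would have total measure above 1. *)
Lemma countable_nonnull d (T : measurableType d) (R : realType)
    (P : probability T R) (J : pointedType) (D : set J) (M : J -> set T) :
  (forall i, D i -> measurable (M i)) -> (forall i, D i -> P (M i) <> 0%E) ->
  (forall i j, D i -> D j -> i <> j -> P (M i `&` M j) = 0%E) ->
  countable D.
Proof.
move=> mM M0 MM.
apply: (@sub_countable _ _ _
  (\bigcup_n [set i | D i /\ (n.+1%:R^-1 < fine (P (M i)))%R])).
  apply/subset_card_le => i Di.
  have : (0 < fine (P (M i)))%R.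
    rewrite fine_gt0// (le_lt_trans (probability_le1 P (mM i Di))) ?ltry// andbT.
    by rewrite lt_neqAle measure_ge0 andbT eq_sym; apply/eqP/M0.
  by move=> /ltr_add_invr[n]; rewrite add0r => ?; exists n.
apply: bigcup_countable => // n _; apply: finite_set_countable.
apply: contrapT => /infiniteP/pcard_leP/injfunPex[q q_fun q_inj].
have Dq m : D (q m) by have [] := q_fun m I.
(* Removing the earlier sets makes the sequence disjoint and costs only null overlaps. *)
pose N := seqDU (M \o q).
have mN m : measurable (N m).
  by apply: measurableD; [exact: mM|apply: bigsetU_measurable => l _; exact: mM].
have PN m : P (N m) = P (M (q m)).
  rewrite measureD ?(le_lt_trans (probability_le1 P (mM _ (Dq m)))) ?ltry//;
    [|exact: mM|by apply: bigsetU_measurable => l _; exact: mM].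
  rewrite [X in (_ - X)%E](_ : _ = 0%E) ?sube0//.
  apply/negligibleP.
    by apply: measurableI; [exact: mM|apply: bigsetU_measurable => l _; exact: mM].
  rewrite big_distrr /= -(big_mkord xpredT (fun l => M (q m) `&` M (q l))) big_seq.
  apply: negligible_bigsetU => l; rewrite mem_index_iota => /andP[_ lm].
  apply/negligibleP; first by apply: measurableI; exact: mM.
  apply: MM => // /(q_inj _ _ (in_setT _) (in_setT _)) ml.
  by rewrite ml ltnn in lm.
have /(probability_le1 P) : measurable (\bigcup_m N m) by exact: bigcup_measurable.
rewrite leNgt => /negP; apply.
rewrite measure_bigcup//; last exact: trivIset_seqDU.
apply: (lt_le_trans _ (nneseries_lim_ge n.+1 _)) => //.
rewrite (eq_big xpredT (fun m => (fine (P (M (q m))))%:E)); first last.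
- by move=> m _; rewrite fineK ?fin_num_measure//; [exact: PN|exact: mM].
- by move=> m; rewrite in_setT.
rewrite sumEFin lte_fin.
rewrite (_ : 1%R = (\sum_(0 <= k < n.+1) n.+1%:R^-1:R)%R); last first.
  by rewrite sumr_const_nat subn0 -[RHS]mulr_natr mulVf.
by apply: ltr_sum => // m _; have [] := q_fun m I.
Qed.

Section Partition.
Context {R : realType} {k : nat} {V : 'I_k -> pointedType}.
Variable G : gradedProbabilitySpace R V.
Implicit Types X Y Z : seq 'I_k.

Lemma same_fiber_refl X Y (E : set (pt V (X ++ Y))) x : same_fiber G E x x.
Proof. exact: ae_all. Qed.

Lemma same_fiber_sym X Y (E : set (pt V (X ++ Y))) x x' :
  same_fiber G E x x' -> same_fiber G E x' x.
Proof. by apply: ae_mono => y; tauto. Qed.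

Lemma same_fiber_trans X Y (E : set (pt V (X ++ Y))) x x' x'' :
  same_fiber G E x x' -> same_fiber G E x' x'' -> same_fiber G E x x''.
Proof. by apply: ae_mono2 => y; tauto. Qed.

Lemma ae_measurable_class X Y (E : set (pt V (X ++ Y))) (x : pt V X) :
  gps_B G E -> ae_measurable G (fiber_fst E x) ->
  ae_measurable G (fun x' => same_fiber G E x' x).
Proof.
move=> BE mEx.
have [_ h _] := fubini_fst (ae_measurable_iff (ae_measurable_B BE)
  (@ae_measurable_snd _ _ _ _ X Y _ mEx)).
apply: ae_measurable_eq h; apply: ae_all => x'.
by split; apply: ae_mono => y; rewrite pt_snd_cat.
Qed.

(** Distinct classes are disjoint, so [countable_nonnull] applies to those of positive measure; [v]
    lists representatives. *)
Lemma countable_atoms X Y (E : set (pt V (X ++ Y))) : gps_B G E ->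
  exists v : nat -> pt V X,
    (forall n, ae_measurable G (fiber_fst E (v n))) /\
    forall x, ae_measurable G (fiber_fst E x) ->
      ~ ae G (fun x' => ~ same_fiber G E x' x) ->
      exists n, same_fiber G E x (v n).
Proof.
move=> BE.
pose cls x : set (pt V X) := [set x' | same_fiber G E x' x].
pose good x := ae_measurable G (fiber_fst E x) /\ ~ ae G (fun x' => ~ cls x x').
pose D : set (set (pt V X)) := [set cls x | x in good].
(* Classes are measurable only up to null sets, hence a measurable version [M c] of each. *)
have /choice[M HM] : forall c : set (pt V X), exists M : set (pt V X), D c ->
    gps_B G M /\ ae G (fun x => M x <-> c x).
  move=> c; have [[x [mx _] <-]|nDc] := pselect (D c); last by exists set0.
  by have [M BM Mx] := ae_measurable_class BE mx; exists M.
have : countable D.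
  apply: (@countable_nonnull _ _ _ (gps_mu G X) _ D M).
  - by move=> c /HM[/gps_measurableP].
  - move=> c Dc; have [BM Mc] := HM c Dc; rewrite -(ae_not_set0 BM) => nM.
    case: Dc nM Mc => x [_ nx] <- nM Mc; apply: nx.
    by apply: ae_mono2 nM Mc => x' nMx [_ Mx] /Mx.
  - move=> c c' Dc Dc' cc'; have [BM Mc] := HM c Dc; have [BM' Mc'] := HM c' Dc'.
    apply/ae_not_set0.
      by apply/gps_measurableP; apply: measurableI; apply/gps_measurableP.
    apply: ae_mono2 Mc Mc' => x Mx Mx' [/Mx cx /Mx' cx']; apply: cc'.
    case: Dc cx => y _ <- xy; case: Dc' cx' => y' _ <- xy'.
    have yy' : same_fiber G E y y' by exact: same_fiber_trans (same_fiber_sym xy) xy'.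
    apply/seteqP; split => z /= zy; first exact: same_fiber_trans zy yy'.
    exact: same_fiber_trans zy (same_fiber_sym yy').
move=> /countable_injP[f finj].
have [x0 mx0] : exists x, ae_measurable G (fiber_fst E x).
  by have [h _ _] := fubini_fst (ae_measurable_B BE); exact: ae_exists h.
have /choice[v Hv] : forall n, exists y, ae_measurable G (fiber_fst E y) /\
    forall x, good x -> f (cls x) = n -> good y /\ f (cls y) = n.
  move=> n.
  have [[x [gx fx]]|no] := pselect (exists x, good x /\ f (cls x) = n).
    by exists x; split; [case: gx|].
  by exists x0; split => // x gx fx; exfalso; apply: no; exists x.
exists v; split => [n|x mx nx]; first by have [] := Hv n.
exists (f (cls x)).
have [_ /(_ x (conj mx nx) erefl) [gv fv]] := Hv (f (cls x)).
have : cls (v (f (cls x))) = cls x.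
  by apply: finj => //; rewrite inE; [exists (v (f (cls x)))|exists x].
by move=> e; rewrite -[same_fiber _ _ _ _]/(cls _ _) e; exact: same_fiber_refl.
Qed.

(** Countably many classes cover almost everything. Up to a null set each is the set [A i] of points
    that agree with [v i] at countably many generic [z (i, j)], hence lies in the sigma-algebra
    generated by [F]. On a set within one class, up to a null set, almost every fiber is almost full
    or almost empty. *)
Lemma atomic_partition X Y (E : set (pt V (X ++ Y))) (F : set (set (pt V X))) :
  gps_B G E -> F `<=` @gps_B _ _ _ G X -> ae G (fun y => F (fiber_snd E y)) ->
  ae G (fun x => ~ ae G (fun x' => ~ same_fiber G E x' x)) ->
  exists P : set (set (pt V X)),
    [/\ countable P, partition P id setT &
        forall A, P A -> <<s F >> A /\ perfect G E A].
Proof.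
move=> BE FB FE atoms; have mE := ae_measurable_B BE.
have FsB : <<s F >> `<=` @gps_B _ _ _ G X.
  by apply: smallest_sub => //; exact: gps_sigma_algebra.
have [v [mv atomv]] := countable_atoms BE.
have aev : ae G (fun x => exists n, same_fiber G E x (v n)).
  have [h _ _] := fubini_fst mE; apply: ae_mono2 atoms h => x nx mx.
  exact: atomv.
(* A generic [y] has its fiber in [F] and does not distinguish, up to null sets, the points of the
   class of any [v n]. *)
pose good y := F (fiber_snd E y) /\ forall n,
  ae G (fun x => same_fiber G E x (v n) -> (E (pt_cat x y) <-> E (pt_cat (v n) y))).
have aegood : ae G good.
  apply: ae_and => //; apply: ae_forall_nat => n.
  have mS : ae_measurable G (fun p : pt V (X ++ Y) =>
      same_fiber G E (pt_fst p) (v n) -> (E p <-> fiber_fst E (v n) (pt_snd p))).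
    apply: ae_measurable_imply.
      exact: (@ae_measurable_fst _ _ _ _ X Y _ (ae_measurable_class BE (mv n))).
    by apply: ae_measurable_iff => //; exact: ae_measurable_snd.
  have [/(_ _)h _] := fubini_swap mS; apply: ae_mono (h _) => [y|].
    by apply: ae_mono => x; rewrite pt_fst_cat pt_snd_cat.
  apply: ae_all => x; have [xv|nxv] := pselect (same_fiber G E x (v n)).
    by apply: ae_mono xv => y xy _; rewrite pt_snd_cat.
  by apply: ae_all => y; rewrite pt_fst_cat => /nxv.
(* Inequivalent [v i] and [v j] differ on a set of positive measure, which therefore contains a
   generic point [z (i, j)]. *)
have /choice[z Hz] : forall ij : nat * nat, exists y, good y /\
    (~ same_fiber G E (v ij.1) (v ij.2) ->
     ~ (E (pt_cat (v ij.1) y) <-> E (pt_cat (v ij.2) y))).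
  move=> [i j] /=.
  have [vij|nvij] := pselect (same_fiber G E (v i) (v j)).
    by have [y gy] := ae_exists aegood; exists y; split.
  have : ~ ae G (fun y => ~ ~ (E (pt_cat (v i) y) <-> E (pt_cat (v j) y))).
    by apply: contra_not nvij; apply: ae_mono => y; rewrite notK.
  by move=> /nonnull_exists/(_ aegood)[y [ny gy]]; exists y.
pose A i : set (pt V X) := [set x | forall j, ~ same_fiber G E (v i) (v j) ->
  (E (pt_cat x (z (i, j))) <-> E (pt_cat (v i) (z (i, j))))].
have mA i : measurable (A i : set (g_sigma_algebraType F)).
  have -> : A i = \bigcap_j [set x | ~ same_fiber G E (v i) (v j) ->
      (E (pt_cat x (z (i, j))) <-> E (pt_cat (v i) (z (i, j))))].
    by apply/seteqP; split => [x Ax j _|x Ax j]; [exact: Ax|exact: (Ax j I)].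
  apply: bigcapT_measurable => j.
  have mFz : measurable (fiber_snd E (z (i, j)) : set (g_sigma_algebraType F)).
    by apply: sub_sigma_algebra; have [[]] := Hz (i, j).
  have [vij|nvij] := pselect (same_fiber G E (v i) (v j)).
    by rewrite (_ : mkset _ = setT)//; apply/seteqP; split.
  have [vE|nvE] := pselect (E (pt_cat (v i) (z (i, j)))).
    rewrite (_ : mkset _ = fiber_snd E (z (i, j)))//.
    by apply/seteqP; split => x; rewrite /fiber_snd /=; tauto.
  rewrite (_ : mkset _ = ~` fiber_snd E (z (i, j))); first exact: measurableC.
  by apply/seteqP; split => x; rewrite /fiber_snd /setC /=; tauto.
have aez : ae G (fun x => forall i j n, same_fiber G E x (v n) ->
    (E (pt_cat x (z (i, j))) <-> E (pt_cat (v n) (z (i, j))))).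
  apply: ae_forall_nat => i; apply: ae_forall_nat => j; apply: ae_forall_nat => n.
  by have [[_ h] _] := Hz (i, j); exact: h.
have aeA : ae G (fun x => (exists i, A i x) /\
    forall i, A i x -> same_fiber G E x (v i)).
  apply: ae_mono2 aev aez => x [n xn] xz; split.
    by exists n => j _; exact: xz.
  (* If [v i] and [v n] were inequivalent, [x] would agree with both at [z (i, n)], where they
     differ. *)
  move=> i Aix; have [vin|nvin] := pselect (same_fiber G E (v i) (v n)).
    exact: same_fiber_trans xn (same_fiber_sym vin).
  have [_ /(_ nvin) /=] := Hz (i, n).
  by have := Aix n nvin; have := xz i n n xn; tauto.
(* Index 0 takes the null remainder, so that the sets cover every point; [A i] moves to index
   [i.+1]. *)
pose C n : set (pt V X) := if n is i.+1 then A i else ~` \bigcup_i A i.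
have mC n : measurable (C n : set (g_sigma_algebraType F)).
  by case: n => // ; apply: measurableC; exact: bigcupT_measurable.
pose N := seqDU C.
have mN n : <<s F >> (N n).
  have : measurable (N n : set (g_sigma_algebraType F)); last by [].
  by apply: measurableD => //; apply: bigsetU_measurable => i _.
have NA n : exists i, ae G (fun x => N n x -> same_fiber G E x (v i)).
  (* The remainder at index 0 is null, so any representative serves. *)
  case: n => [|i]; [exists 0%N|exists i]; apply: ae_mono aeA => x [[j Aj] Av] [Cx _].
    by exfalso; apply: Cx; exists j.
  exact: Av.
(* Empty pieces are discarded because the members of a partition are nonempty. *)
exists [set B | (exists n, B = N n) /\ B !=set0]; split.
- apply: (@sub_countable _ _ _ (range N)); last first.
    exact: sub_countable (card_image_le _ _) _.
  by apply/subset_card_le => B [[n ->] _]; exists n.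
- split=> [||B []//].
  + apply/seteqP; split=> // x _.
    have : (\bigcup_n C n) x.
      have [[i _ Aix]|nA] := pselect ((\bigcup_i A i) x); last by exists 0%N.
      by exists i.+1.
    rewrite seqDU_bigcup_eq => -[n _ Nx]; exists (N n) => //.
    by split; [exists n|exists x].
  + move=> _ _ [[n ->] _] [[m ->] _] nm; congr N.
    by apply: (@trivIset_seqDU _ C) => //.
- move=> _ [[n ->] _]; split => //; split; first exact/FsB.
  have BN : gps_B G (N n) by exact/FsB.
  have [i Nv] := NA n.
  have mS : ae_measurable G (fun p : pt V (X ++ Y) =>
      N n (pt_fst p) -> (E p <-> fiber_fst E (v i) (pt_snd p))).
    apply: ae_measurable_imply; first exact/ae_measurable_fst/ae_measurable_B.
    by apply: ae_measurable_iff => //; exact: ae_measurable_snd.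
  have [/(_ _)h _] := fubini_swap mS.
  have {}h : ae G (fun y => ae G (fun x =>
      N n x -> (E (pt_cat x y) <-> E (pt_cat (v i) y)))).
    apply: ae_mono (h _) => [y|].
      by apply: ae_mono => x; rewrite pt_fst_cat pt_snd_cat.
    apply: ae_mono Nv => x Nv; have [Nx|nNx] := pselect (N n x).
      by apply: ae_mono (Nv Nx) => y xy _; rewrite pt_snd_cat.
    by apply: ae_all => y; rewrite pt_fst_cat => /nNx.
  apply: (ae_mono2 _ h FE) => y hy /FB /gps_measurableP By.
  have /gps_measurableP mNn := BN.
  have [vE|nvE] := pselect (E (pt_cat (v i) y)); [right|left]; apply/ae_not_set0.
  + by apply/gps_measurableP; exact: measurableD.
  + by apply: ae_mono hy => x hx [Nx nE]; apply: nE; rewrite /fiber_snd /=; tauto.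
  + by apply/gps_measurableP; exact: measurableI.
  + by apply: ae_mono hy => x hx [Nx]; rewrite /fiber_snd /=; tauto.
Qed.

End Partition.

(** * Ternary relations: fibers as boxes, and measurability of partial classes *)

Section TernaryRelations.
Context {R : realType} {k : nat} {V : 'I_k -> pointedType}.
Variable G : gradedProbabilitySpace R V.
Implicit Types X Y Z : seq 'I_k.

Lemma rel_assocE X Y Z (E : set (pt V (X ++ (Y ++ Z)))) x y z :
  rel_assoc E (pt_cat (pt_cat x y) z) = E (pt_cat x (pt_cat y z)).
Proof.
rewrite /rel_assoc /=; congr E; apply: val_inj.
by rewrite val_pt_cast /= catA.
Qed.

Lemma rel_assoc_B X Y Z (E : set (pt V (X ++ (Y ++ Z)))) :
  gps_B G E -> gps_B G (rel_assoc E).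
Proof.
move=> BE; apply: (proj1 (gps_coords (u := iota 0 (size ((X ++ Y) ++ Z))) _ _ _ BE)).
- by move=> p; rewrite val_pt_cast; exact: coord_map_id.
- exact: iota_uniq.
- by apply/allP => i; rewrite mem_iota.
Qed.

Lemma positions_filter n (I : {set 'I_n}) (P : pred nat) :
  (forall i : 'I_n, (i \in I) = P i) -> positions I = [seq i <- iota 0 n | P i].
Proof.
move=> IP; rewrite /positions -val_enum_ord filter_map enumT.
by congr map; apply: eq_filter => i; exact: IP.
Qed.

Lemma filter_iota_ltn m l : [seq i <- iota 0 (m + l) | (i < m)%N] = iota 0 m.
Proof.
rewrite iotaD filter_cat (all_filterP _).
  rewrite (eq_in_filter (a2 := pred0)) ?filter_pred0 ?cats0//.
  by move=> i; rewrite mem_iota /=; lia.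
by apply/allP => i; rewrite mem_iota.
Qed.

Lemma filter_iota_geq m l : [seq i <- iota 0 (m + l) | ~~ (i < m)%N] = iota m l.
Proof.
rewrite iotaD filter_cat (eq_in_filter (a2 := pred0)) ?filter_pred0.
  by rewrite (all_filterP _)//; apply/allP => i; rewrite mem_iota add0n; lia.
by move=> i; rewrite mem_iota /=; lia.
Qed.

(** A single box suffices: [J] is the set of all positions of [X ++ Y], and [I] that of the first
    [n] positions of [W], so that [z] gives the coordinates outside [I]. *)
Lemma fiber_snd_boxes X Y Z (E : set (pt V (X ++ (Y ++ Z)))) (z : pt V Z) :
  gps_B G (fiber_snd (rel_assoc E) z) ->
  fiber_boxes G E (X ++ Y) 1 (fiber_snd (rel_assoc E) z).
Proof.
move=> BEz.
pose W := X ++ (Y ++ Z); pose n := size (X ++ Y).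
have sW : size W = (n + size Z)%N by rewrite /W /n !size_cat addnA.
pose I : {set 'I_(size W)} := [set i : 'I_(size W) | (i < n)%N]%SET.
have posI : positions I = iota 0 n.
  rewrite (positions_filter (P := fun i => (i < n)%N)) ?sW ?filter_iota_ltn//.
  by move=> i; rewrite inE.
have posCI : positions (~: I)%SET = iota n (size Z).
  rewrite (positions_filter (P := fun i => ~~ (i < n)%N)) ?sW ?filter_iota_geq//.
  by move=> i; rewrite !inE.
have posJ : positions [set: 'I_n]%SET = iota 0 n.
  rewrite (positions_filter (P := predT)) ?filter_predT//.
  by move=> i; rewrite inE.
have eZ : Z = coords (positions (~: I)%SET) W.
  by rewrite posCI coords_iota /W catA drop_size_cat// take_size.
have eXY : coords (positions I) W = X ++ Y.
  by rewrite posI coords_iota drop0 /W catA take_size_cat.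
have eJ : coords (positions [set: 'I_n]%SET) (X ++ Y) = coords (positions I) W.
  by rewrite eXY posJ coords_iota drop0 take_size.
have coI T (s : seq T) : coords (positions I) s = take n s.
  by rewrite posI coords_iota drop0.
have coCI T (s : seq T) : coords (positions (~: I)%SET) s = take (size Z) (drop n s).
  by rewrite posCI coords_iota.
pose b := pt_cast eZ z.
have fiberE a : fiber_at E b a <-> fiber_snd (rel_assoc E) z (pt_cast eXY a).
  (* Points of different sorts are compared through their underlying sequences, which casts leave
     unchanged. *)
  have rawE (p : pt V W) (q : pt V (X ++ Y)) : val p = val q ++ val z ->
      E p = fiber_snd (rel_assoc E) z q.
    move=> pq; rewrite /fiber_snd /rel_assoc /=; congr E; apply: val_inj.
    by rewrite val_pt_cast.
  split=> [[w [Ew wa wb]]|Ea].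
    rewrite -(rawE w)// val_pt_cast -wa -(val_pt_cast eZ z) -/b -wb /=.
    rewrite posI posCI !coords_iota drop0.
    rewrite [X in _ = _ ++ X]take_oversize ?cat_take_drop//.
    by rewrite size_drop size_val_pt sW addKn.
  pose w : pt V W := pt_cast (esym (catA X Y Z)) (pt_cat (pt_cast eXY a) z).
  have vw : val w = val a ++ val z by rewrite val_pt_cast /= val_pt_cast.
  have sa : size (val a) = n by rewrite size_val_pt eXY.
  exists w; split.
  - by rewrite (rawE w (pt_cast eXY a))// vw val_pt_cast.
  - by apply: val_inj; rewrite /= vw [LHS]coI take_size_cat.
  - apply: val_inj; rewrite /= vw [LHS]coCI drop_size_cat//.
    by rewrite val_pt_cast -(size_val_pt z) take_size.
exists (fun=> [set: 'I_n]%SET), (fun=> I), (fun=> eJ), (fun=> fiber_at E b).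
split=> [_|].
  split; last by exists b; left.
  have -> : fiber_at E b = pt_cast eXY @^-1` fiber_snd (rel_assoc E) z.
    by apply/seteqP; split => a /fiberE.
  by move: (coords _ _) eXY {eJ fiberE} => s e; subst s.
apply/seteqP; split=> p.
  move=> Ep l; apply/fiberE; rewrite [X in fiber_snd _ _ X](_ : _ = p)//.
  apply: val_inj; rewrite !val_pt_cast /= posJ coords_iota drop0.
  by rewrite take_oversize// size_val_pt.
move=> /(_ ord0)/fiberE; rewrite [X in fiber_snd _ _ X](_ : _ = p)//.
apply: val_inj; rewrite !val_pt_cast /= posJ coords_iota drop0.
by rewrite take_oversize// size_val_pt.
Qed.

(** This measurability is what permits exchanging the quantifiers over [x] and [y]. The maps [c1]
    and [c2] send (x',(x,y),z) to ((x',y),z) and ((x,y),z). *)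
Lemma ae_measurable_atom_mid X Y Z (E : set (pt V (X ++ (Y ++ Z)))) :
  gps_B G E ->
  ae_measurable G (fun p : pt V (X ++ Y) => ae G (fun x' => ~ same_fiber G
    (rel_assoc E) (pt_cat x' (pt_snd p)) p)).
Proof.
move=> /rel_assoc_B BE; have mE := ae_measurable_B BE.
have idm := @coord_map_id _ V ((X ++ (X ++ Y)) ++ Z).
have mx' := coord_map_fst (coord_map_fst idm).
have mp := coord_map_snd (coord_map_fst idm).
have mz := coord_map_snd idm.
have c1 := coord_map_cat (coord_map_cat mx' (coord_map_snd mp)) mz.
have c2 := coord_map_cat mp mz.
have m1 := ae_measurable_preimage c1 _ _ mE.
have m2 := ae_measurable_preimage c2 _ _ mE.
have [||||_ h _] := fubini_fst (ae_measurable_iff (m1 _ _) (m2 _ _)); try iota_lia.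
have [_ {}h _] := fubini_snd (ae_measurable_not h).
apply: ae_measurable_eq h; apply: ae_all => p.
split; apply: ae_mono => x'; apply: contra_not => h.
  by apply: ae_mono h => z; rewrite !pt_fst_cat !pt_snd_cat.
by apply: ae_mono h => z; rewrite !pt_fst_cat !pt_snd_cat.
Qed.

End TernaryRelations.

Theorem theorem6p5 (R : realType) (k : nat) (V : 'I_k -> pointedType)
    (G : gradedProbabilitySpace R V) (X Y Z : seq 'I_k)
    (E : set (pt V (X ++ (Y ++ Z)))) :
  gps_B G E ->
  (\forall x \ae gps_mu G X, mu_stable G (fiber_fst E x)) ->
  (\forall y \ae gps_mu G Y, mu_stable G (fiber_mid E y)) ->
  exists P : set (set (pt V (X ++ Y))),
    [/\ countable P,
        partition P id setT &
        forall A, P A ->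
          fiber_algebra G E (X ++ Y) A /\ perfect G (rel_assoc E) A].
Proof.
move=> BE stx sty; have BE' := rel_assoc_B BE; have mE' := ae_measurable_B BE'.
pose same := same_fiber G (rel_assoc E).
(* [stable_atomic] for the fiber over [x]: moving only [y] meets the class of [(x, y)] in positive
   measure. *)
have atomx : ae G (fun x => ae G (fun y =>
    ~ ae G (fun y' => ~ same (pt_cat x y') (pt_cat x y)))).
  apply: ae_mono stx => x [d _ [BEx tree0]].
  apply: ae_mono (stable_atomic BEx tree0) => y; apply: contra_not.
  apply: ae_mono => y'; apply: contra_not; apply: ae_mono => z.
  by rewrite !rel_assocE.
(* The same for moving only [x]; stability of the fibers over [y] gives the quantifiers in the order
   y, x, and Fubini exchanges them. *)
have atomy : ae G (fun x => ae G (fun y =>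
    ~ ae G (fun x' => ~ same (pt_cat x' y) (pt_cat x y)))).
  have m := ae_measurable_not (ae_measurable_atom_mid BE).
  have [_ /(_ _)h] := fubini_swap m.
  apply: ae_mono (h _) => [x|].
    by apply: ae_mono => y; rewrite pt_snd_cat.
  apply: ae_mono sty => y [d _ [BEy tree0]].
  apply: ae_mono (stable_atomic BEy tree0) => x; apply: contra_not.
  rewrite pt_snd_cat; apply: ae_mono => x'; apply: contra_not; apply: ae_mono => z.
  by rewrite /fiber_mid /= !rel_assocE !pt_fst_cat !pt_snd_cat.
have atoms : ae G (fun p => ~ ae G (fun p' => ~ same p' p)).
  have m := ae_measurable_not (ae_measurable_atom BE').
  have [_ _ [_ h]] := fubini_fst m; apply: h.
  (* For almost all [(x, y)] the fiber is measurable, which makes the class of [(x, y)] measurable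
     and lets Fubini apply to it. *)
  have [mE'p _ _] := fubini_fst mE'.
  have [_ _ [/(_ mE'p) mE'xy _]] := fubini_fst (ae_measurable_ae mE'p).
  apply: ae_mono2 (ae_and atomx atomy) mE'xy => x [atx aty] mx.
  apply: ae_mono2 atx mx => y nxy mxy null; apply: nxy.
  have mcls := ae_measurable_class BE' mxy.
  (* If the class of [(x, y)] is null, then for almost every [y'] it contains almost no [(x', y')];
     but for [(x, y')] in the class, [atomy] and transitivity give a non-null set of such [x']. *)
  have [_ _ [/(_ null) null' _]] := fubini_snd (ae_measurable_not mcls).
  apply: ae_mono2 aty null' => y' aty' null'y'; apply: contra_not aty' => s.
  apply: ae_mono null'y' => x'; apply: contra_not => s'.
  exact: same_fiber_trans s' s.
(* The measurable fibers over points of [Z]: almost all fibers, and each belongs to the fiber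
   algebra. *)
pose F : set (set (pt V (X ++ Y))) :=
  [set A | gps_B G A /\ exists z, A = fiber_snd (rel_assoc E) z].
have FB : F `<=` @gps_B _ _ _ G (X ++ Y) by move=> A [].
have [|P [cP pP HP]] := atomic_partition BE' FB _ atoms.
  have [h _ _] := fubini_B BE'; apply: ae_mono h => z Bz.
  by split=> //; exists z.
exists P; split=> // A /HP[FA pA]; split => //.
apply: sub_sigma_algebra2 FA => B [BB [z Bz]]; exists 1%N => //; rewrite Bz.
by apply: fiber_snd_boxes; rewrite -Bz.
Qed.
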